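(* Let $(X,\mathcal{B},\mu,T)$ be a measure preserving $(\mathbb{N},\times)$-system and let $A\in\mathcal{B}$ with $\mu(A)>0$. Let $G$ be a subsemigroup of $(\mathbb{N},\times)$. Then for every $\ell\in\mathbb{N}$, $$\limsup_{N\to\infty}\ \mathbb{E}_{n\in G\cap[N]}\ \mu\big(A\cap T_n^{-1}A\cap T_{n^2}^{-1}A\cap\cdots\cap T_{n^\ell}^{-1}A\big)>0.$$
   Context: $\mathbb{N}=\{1,2,\dots\}$ and $[N]=\{1,\dots,N\}$. For a finite nonempty set $E$ and $f:E\to\mathbb{C}$, $\mathbb{E}_{n\in E}f(n):=\frac1{|E|}\sum_{n\in E}f(n)$; averages over $G\cap[N]$ are considered for $N$ large enough that $G\cap[N]\neq\emptyset$. Subsemigroups are nonempty. A measure preserving $(\mathbb{N},\times)$-system $(X,\mathcal{B},\mu,T)$ consists of a probability space $(X,\mathcal{B},\mu)$ and measure preserving transformations $T_n:X\to X$, $n\in\mathbb{N}$, with $T_{nm}=T_n\circ T_m$ for all $n,m\in\mathbb{N}$. *)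

(* Defs.v *)
From HB Require Import structures.
From mathcomp Require Import all_boot all_order all_algebra finmap.
From mathcomp Require Import all_classical all_reals all_analysis.

Set Implicit Arguments.
Unset Strict Implicit.
Unset Printing Implicit Defensive.

Import Order.TTheory GRing.Theory Num.Theory.
Import numFieldNormedType.Exports.

Local Open Scope classical_set_scope.
Local Open Scope ring_scope.

(* The semigroup (N, x) is modelled by the positive elements of nat: the value
   of a family of maps at 0 is left unconstrained. *)
Definition measure_preserving_map (d : measure_display) (X : measurableType d)
    (R : realType) (mu : probability X R) (S : X -> X) : Prop :=
  measurable_fun [set: X] S /\
  forall A : set X, measurable A -> mu (S @^-1` A) = mu A.

Record mult_system (d : measure_display) (X : measurableType d) (R : realType)
    (mu : probability X R) (T : nat -> X -> X) : Prop := MultSystem {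
  mult_system_preserving :
    forall n : nat, (0 < n)%N -> measure_preserving_map mu (T n);
  mult_system_comp :
    forall n m : nat, (0 < n)%N -> (0 < m)%N -> T (n * m)%N = T n \o T m
}.

Record mult_subsemigroup (G : set nat) : Prop := MultSubsemigroup {
  mult_subsemigroup_nonempty : G !=set0;
  mult_subsemigroup_gt0 : forall n : nat, G n -> (0 < n)%N;
  mult_subsemigroup_mul : forall n m : nat, G n -> G m -> G (n * m)%N
}.

Definition initial_segment (N : nat) : set nat := [set n | (1 <= n <= N)%N].

(* Meaningful for finite nonempty E; the value is 0 when E is empty. *)
Definition average (R : realType) (E : set nat) (f : nat -> R) : R :=
  (#|` fset_set E|%:R)^-1 * \sum_(n \in E) f n.

Definition multiple_return (X : Type) (T : nat -> X -> X) (A : set X)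
    (l n : nat) : set X :=
  A `&` \bigcap_(k in [set k | (1 <= k <= l)%N]) (T (n ^ k)%N @^-1` A).

(* Main.v *)
Require Import Defs.
From HB Require Import structures.
From mathcomp Require Import all_boot all_order all_algebra finmap.
From mathcomp Require Import all_classical all_reals all_analysis.
From mathcomp Require Import measurable_realfun ring lra.

Set Implicit Arguments.
Unset Strict Implicit.
Unset Printing Implicit Defensive.

Import Order.TTheory GRing.Theory Num.Theory.
Import numFieldNormedType.Exports.

Local Open Scope classical_set_scope.
Local Open Scope ring_scope.

(** Write E n for [multiple_return T A l n].  If the limsup were not positive,
    then for every eps > 0 the set of those n in G with mu (E n) >= eps would
    have density zero relative to G.  Two facts exclude this.

    First, a set of relative density zero in G can be avoided by multiplicative
    structure.  The counting function of G is at most N, so it cannot be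
    multiplied by M^2 each time N is multiplied by M; hence for every M there
    are arbitrarily large N at which it grows by at most M^2 between N and M*N
    ([subquadratic_growth]).  At such N, given finitely many y <= M with
    y*G contained in G, some n in G up to N has no exceptional product n*y
    ([dilates_avoid]).  Picking elements of G one at a time gives, for each
    finite I, a family x in G all of whose nonempty subproducts n satisfy
    mu (E n) < eps ([subproducts_avoid]).

    Second, such a family always has a subproduct n with mu (E n) >= eps, once
    eps is small and I is large in terms of mu A and l.  For a word w over the
    digits 0, ..., l put p w = prod_i x_i ^ (w_i).  The preimages of A under the
    maps T (p w) all have measure mu A.  By the density Hales-Jewett theorem a
    point that lies in a proportion mu A / 2 of them lies in all those indexed
    by some combinatorial line, and there are boundedly many lines, so some
    line has an intersection of measure >= eps ([probability_line]).  Along a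
    line p takes the values n^k * c, k <= l, where n is the product of the x_i
    at the wildcards; so this intersection is contained in the preimage of E n
    under T c, which has the measure of E n.

    The density Hales-Jewett theorem itself is proved by induction on the
    alphabet, from K to [option K] with new letter [None], by a density
    increment in the style of Polymath and of Dodos, Kanellopoulos and Tyros.
    Let d be the infimum of the densities that force a line over [option K],
    and let A be a set of words without lines whose density is barely below d.
    No fibre of A can have density much above d, so all fibres over a short
    prefix have density close to d ([dense_fibres]).  The theorem for K then
    provides in A many lines deprived of their last point.  A padding argument
    produces from these a subspace in which the last points that complete such
    lines form a dense set D, an intersection of sets that do not distinguish
    [None] from one of the other letters.  As A misses D, its density on the
    complement of D is at least d + g, with g depending on d and K only
    ([DHJ_below]).  But the complement is a finite union of intersections of
    such insensitive sets, and these can be partitioned almost entirely into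
    subspaces of any prescribed dimension ([intersection_partition]), so A has
    density at least d + g in one of them, and contains a line after all. *)

(** * Words, lines and subspaces *)

(** Index sets are arbitrary finite types: concatenation and division into
    blocks become sums and products of index types. *)
Definition word (I K : finType) : finType := {ffun I -> K}.

Definition line (I K : finType) (L : word I (option K)) (a : K) : word I K :=
  [ffun i => odflt a (L i)].

Definition contains_line (I K : finType) (D : pred (word I K)) : Prop :=
  exists L : word I (option K),
    (exists i, L i = None) /\ forall a, D (line L a).

Definition has_density (R : realType) (X : finType) (c : R) (D : pred X) :=
  c * #|X|%:R <= \sum_x (D x)%:R.

(** One index type suffices for the induction; averaging over fibres would give
    the property for all larger ones. *)
Definition DHJ (R : realType) (K : finType) (c : R) : Prop :=
  exists I : finType,
    forall D : pred (word I K), has_density c D -> contains_line D.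

(** A word V over J + K encodes a combinatorial subspace of dimension #|J|:
    [inl j] is a place of the j-th wildcard, [inr a] a fixed letter. *)
Definition subst (J I K : finType) (V : word I (J + K)%type) (x : word J K) :
  word I K := [ffun i => match V i with inl j => x j | inr a => a end].

Definition spans (J I K : finType) (V : word I (J + K)%type) : bool :=
  [forall j, exists i, V i == inl j].

Definition wcat (I J K : finType) (x : word I K) (y : word J K) :
  word (I + J)%type K :=
  [ffun q => match q with inl i => x i | inr j => y j end].

(** * Averaging and pigeonhole *)

Lemma sum_indicator_le_card (R : realType) (X : finType) (D : pred X) :
  \sum_x (D x)%:R <= #|X|%:R :> R.
Proof.
by rewrite -sum1_card natr_sum; apply: ler_sum => x _; case: (D x).
Qed.

Lemma heavy_fibres (R : realType) (X Y : finType) (c : R)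
    (D : X -> Y -> bool) : (0 < #|X|)%N -> 0 <= c ->
  c * (#|X|%:R * #|Y|%:R) <= \sum_x \sum_y (D x y)%:R ->
  has_density (c / 2) (fun y => has_density (c / 2) (D^~ y)).
Proof.
move=> X0 c0 hD; rewrite /has_density.
have : \sum_x \sum_y (D x y)%:R <=
   \sum_y (#|X|%:R * (has_density (c / 2) (D^~ y))%:R + c / 2 * #|X|%:R) :> R.
  rewrite exchange_big /=; apply: ler_sum => y _.
  case: (boolP (has_density _ _)) => h /=.
    rewrite mulr1; apply: le_trans (sum_indicator_le_card _ _) _.
    by rewrite lerDl mulr_ge0 ?divr_ge0.
  by rewrite mulr0 add0r ltW // ltNge.
rewrite big_split /= -mulr_sumr sumr_const -[X in _ + X]mulr_natr => h.
have Xp : 0 < #|X|%:R :> R by rewrite ltr0n.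
by rewrite -(ler_pM2l Xp); have := le_trans hD h; rewrite /has_density; nra.
Qed.

Lemma pigeonhole_density (R : realType) (X L : finType) (c : R)
    (P : pred L) (E : L -> pred X) (D : pred X) : 0 < c -> (0 < #|X|)%N ->
  has_density c D -> (forall x, D x -> exists2 l, P l & E l x) ->
  exists2 l, P l & has_density (c / #|L|%:R) (E l).
Proof.
move=> c0 X0 hD hE.
have Xp : 0 < #|X|%:R :> R by rewrite ltr0n.
have [x Dx] : exists x, D x.
  apply: contrapT => hn; move: hD; rewrite /has_density big1 => [|x _].
    by rewrite leNgt mulr_gt0.
  by case Dx: (D x) => //; case: hn; exists x.
have [l0 _ _] := hE x Dx.
have Lp : 0 < #|L|%:R :> R by rewrite ltr0n; apply/card_gt0P; exists l0.
apply: contrapT => hn.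
have : \sum_x (D x)%:R < c * #|X|%:R :> R.
  apply: (@le_lt_trans _ _ (\sum_l \sum_x ((P l && E l x)%:R : R))).
    rewrite exchange_big /=; apply: ler_sum => z _.
    case Dz: (D z) => /=; last by apply: sumr_ge0.
    have [l Pl El] := hE z Dz.
    by rewrite (bigD1 l) //= Pl El lerDl sumr_ge0.
  have -> : c * #|X|%:R = \sum_(l : L) (c / #|L|%:R * #|X|%:R).
    by rewrite sumr_const -[RHS]mulr_natr; field; rewrite lt0r_neq0.
  apply: ltr_sum => [|l _]; first by apply/hasP; exists l0; rewrite ?mem_index_enum.
  case Pl: (P l) => /=; last by rewrite big1 // mulr_gt0 ?divr_gt0.
  by rewrite ltNge; apply/negP => h; apply: hn; exists l.
by move: hD; rewrite /has_density leNgt => /negP.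
Qed.

Lemma sum_wcat (R : realType) (I J K : finType) (F : word (I + J)%type K -> R) :
  \sum_w F w = \sum_x \sum_y F (wcat x y).
Proof.
rewrite pair_big /=.
pose g (w : word (I + J)%type K) : word I K * word J K :=
  ([ffun i => w (inl i)], [ffun j => w (inr j)]).
rewrite (reindex (fun p : word I K * word J K => wcat p.1 p.2)) //=.
exists g => [[x y] _ | w _].
  by congr pair; apply/ffunP => i; rewrite !ffunE.
by apply/ffunP => -[i|j]; rewrite !ffunE.
Qed.

Lemma card_word_gt0 (I K : finType) : (0 < #|K|)%N -> (0 < #|word I K|)%N.
Proof. by move=> K0; rewrite card_ffun expn_gt0 K0. Qed.

Lemma card_word_sum (I J K : finType) :
  #|word (I + J)%type K| = (#|word I K| * #|word J K|)%N.
Proof. by rewrite !card_ffun card_sum expnD. Qed.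

(** * Insensitive sets contain subspaces *)

Definition splice (I Z T K : finType) (s : T -> K) (e : Z -> I)
    (w : word I K) (v : word Z T) : word I K :=
  [ffun i => if [pick t | e t == i] is Some t then s (v t) else w i].

Lemma splice_in (I Z T K : finType) (s : T -> K) (e : Z -> I) w v t :
  injective e -> splice s e w v (e t) = s (v t).
Proof.
by move=> inj; rewrite ffunE; case: pickP => [u /eqP/inj->|/(_ t)]; rewrite ?eqxx.
Qed.

Lemma splice_out (I Z T K : finType) (s : T -> K) (e : Z -> I) w v i :
  (forall t, e t != i) -> splice s e w v i = w i.
Proof. by move=> h; rewrite ffunE; case: pickP => // t; rewrite (negPf (h t)). Qed.

(** Overwriting a random word by an independent random word does not change its
    distribution: exchanging the overwritten part of w with v is an involution
    on the pairs (w, v).  The places e may depend on w, as long as they do not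
    depend on what is overwritten. *)
Lemma sum_splice (R : realType) (I Z T K : finType) (s : T -> K) (g : K -> T)
    (B : pred (word I K)) (e : word I K -> Z -> I) (F : word I K -> R) :
  cancel s g ->
  (forall w, B w -> injective (e w)) ->
  (forall w v, B w -> B (splice s (e w) w v)) ->
  (forall w v, B w -> e (splice s (e w) w v) = e w) ->
  (forall w t, B w -> s (g (w (e w t))) = w (e w t)) ->
  \sum_(w | B w) \sum_v F (splice s (e w) w v) =
  #|word Z T|%:R * \sum_(w | B w) F w.
Proof.
move=> sK inj hB he hg.
pose h (p : word I K * word Z T) :=
  (splice s (e p.1) p.1 p.2, [ffun t => g (p.1 (e p.1 t))] : word Z T).
have hK p : B p.1 -> h (h p) = p.
  case: p => w v /= Bw; rewrite /h /= he //; congr pair; last first.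
    by apply/ffunP => t; rewrite ffunE splice_in ?sK //; apply: inj.
  apply/ffunP => i; rewrite ffunE; case: pickP => [t /eqP<-|no].
    by rewrite ffunE hg.
  by rewrite splice_out // => t; rewrite no.
transitivity (\sum_(p : word I K * word Z T | B p.1) F (h p).1).
  by rewrite pair_big /=; apply: eq_big => [[w v]|[w v] _] //=; rewrite andbT.
transitivity (\sum_(p : word I K * word Z T | B p.1) F p.1); last first.
  transitivity (\sum_(w | B w) \sum_(v : word Z T) F w).
    by rewrite pair_big /=; apply: eq_big => [[w v]|[w v] _] //=; rewrite andbT.
  by rewrite mulr_sumr; apply: eq_bigr => w _; rewrite sumr_const mulr_natl.
symmetry; rewrite (reindex_onto h h) => [|p Bp]; last exact: hK.
apply: eq_bigl => -[w v] /=; apply/andP/idP => [[Bw /eqP e1]|Bw].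
  by have hh : B (h (h (w, v))).1 := hB _ _ Bw; rewrite e1 in hh.
by split; [exact: hB | rewrite hK].
Qed.

Lemma exists_small_power (R : realType) (c : R) : 0 < c ->
  exists n, (3 / 4) ^+ n <= c.
Proof.
move=> c0.
have bern n : (n%:R + 3) * (3 / 4) ^+ n <= 3 :> R.
  elim: n => [|n IH]; first by rewrite expr0; lra.
  rewrite exprS -natr1.
  have : 0 <= (3 / 4) ^+ n :> R by apply: exprn_ge0; lra.
  have : 0 <= n%:R :> R by [].
  by nra.
have [n hn] : exists n, 3 / c < n%:R :> R.
  by exists (Num.truncn (3 / c)).+1; apply: truncnS_gt.
exists n; have := bern n; move: hn; rewrite ltr_pdivrMr // => hn.
have : 0 <= (3 / 4) ^+ n :> R by apply: exprn_ge0; lra.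
by have : 0 <= n%:R :> R by []; nra.
Qed.

(** Two words differ only by exchanging some letters i and [None] exactly when
    their collapses agree. *)
Definition collapse (I T : finType) (i : T) (x : word I (option T)) :
  word I (option T) := [ffun j => if x j is Some a then Some a else Some i].

Definition insensitive (I T : finType) (i : T) (D : pred (word I (option T))) :=
  forall x, D x = D (collapse i x).

(** Markov's inequality for 2^(- number of letters other than [None]), whose
    mean is (1/2 + 1/2 * P(None))^n <= (3/4)^n. *)
Lemma few_short_words (R : realType) (n N : nat) (T : finType) :
  (0 < #|T|)%N ->
  \sum_(w : word 'I_n (option T)) (#|[pred j | w j]| < N)%N%:R <=
    2 ^+ N * (3 / 4) ^+ n * #|word 'I_n (option T)|%:R :> R.
Proof.
move=> T0.
pose h (a : option T) : R := if a then 2^-1 else 1.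
have hprod (w : word 'I_n (option T)) :
    \prod_j h (w j) = 2^-1 ^+ #|[pred j | w j : bool]|.
  rewrite (bigID [pred j | w j : bool]) /= mulrC big1 ?mul1r => [|j].
    by rewrite (eq_bigr (fun=> 2^-1)) ?prodr_const // => j; rewrite /h => ->.
  by rewrite /h; case: (w j).
apply: (@le_trans _ _ (\sum_(w : word 'I_n (option T)) 2 ^+ N * \prod_j h (w j))).
  apply: ler_sum => w _; rewrite hprod.
  have p0 : 0 <= 2^-1 ^+ #|[pred j | w j : bool]| :> R by rewrite exprn_ge0 ?invr_ge0.
  case: ltnP => [lt|_] /=; last by rewrite mulr_ge0 // exprn_ge0.
  rewrite -(subnKC (ltnW lt)) exprD mulrAC -exprMn.
  rewrite (_ : 2 * 2^-1 = 1 :> R); last by field.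
  by rewrite expr1n mul1r exprn_ege1 // ler1n.
rewrite -mulr_sumr -mulrA ler_pM2l ?exprn_gt0 //.
rewrite -(bigA_distr_bigA (fun _ => h)) /= prodr_const card_ord.
rewrite card_ffun card_ord natrX -exprMn; apply: lerXn2r.
- by rewrite nnegrE sumr_ge0 // => a _; rewrite /h; case: a => *; rewrite ?invr_ge0.
- by rewrite nnegrE mulr_ge0 //; lra.
have -> : \sum_a h a = (#|T|.+1%:R + 1) / 2.
  rewrite (bigD1 None) //= (eq_bigr (fun=> 2^-1)); last first.
    by case.
  rewrite sumr_const (_ : #|_| = #|T|); last first.
    have := cardC1 (None : option T); rewrite card_option /= => <-.
    by apply: eq_card => a; rewrite !inE.
  by rewrite /h /= -[_ *+ #|T|]mulr_natr -[#|T|.+1%:R]natr1; field.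
rewrite card_option -natr1.
have : 1 <= #|T|%:R :> R by rewrite ler1n.
lra.
Qed.

Lemma collapse_idem (I T : finType) (i : T) (x : word I (option T)) :
  collapse i (collapse i x) = collapse i x.
Proof. by apply/ffunP => j; rewrite !ffunE; case: (x j). Qed.

Lemma collapse_wcat (I J T : finType) (i : T) (x : word I (option T))
    (y : word J (option T)) :
  collapse i (wcat x y) = wcat (collapse i x) (collapse i y).
Proof. by apply/ffunP => -[q|q]; rewrite !ffunE. Qed.

Lemma insensitive_fibre (I J T : finType) (i : T)
    (D : pred (word (I + J)%type (option T))) (x : word I (option T)) :
  insensitive i D -> insensitive i (fun y => D (wcat x y)).
Proof.
move=> hD y; rewrite hD collapse_wcat [RHS]hD collapse_wcat.
by rewrite collapse_idem.
Qed.

Lemma insensitive_fibre_l (I J T : finType) (i : T)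
    (D : pred (word (I + J)%type (option T))) (y : word J (option T)) :
  insensitive i D -> insensitive i (fun x => D (wcat x y)).
Proof.
move=> hD x; rewrite hD collapse_wcat [RHS]hD collapse_wcat.
by rewrite collapse_idem.
Qed.

(** Condition a random word on the places of its letters [None].  With high
    probability there are enough other places to apply the theorem for T to the
    letters there, which are uniform in T; this gives a line up to its last
    point, and the last point belongs to D because it collapses to the same
    word as the point with letter i. *)
Lemma insensitive_line (R : realType) (T : finType) (i : T) (c : R) :
  0 < c -> DHJ T (c / 2) ->
  exists I : finType, forall D : pred (word I (option T)),
    insensitive i D -> has_density c D -> contains_line D.
Proof.
move=> c0 [N0 hN0].
have T0 : (0 < #|T|)%N by apply/card_gt0P; exists i.
have [n hn] : exists n, (3 / 4) ^+ n <= c / 4 / 2 ^+ #|N0| :> R.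
  by apply: exists_small_power; rewrite !divr_gt0 ?exprn_gt0.
have hn' : 2 ^+ #|N0| * (3 / 4) ^+ n.+1 <= c / 4 :> R.
  rewrite mulrC -ler_pdivlMr ?exprn_gt0 //; apply: le_trans hn.
  rewrite exprS; have : 0 <= (3 / 4) ^+ n :> R by apply: exprn_ge0; lra.
  lra.
exists 'I_n.+1 => D hD dD.
pose B (w : word 'I_n.+1 (option T)) := (#|N0| <= #|[pred j | w j : bool]|)%N.
(* the default ord0 is reached only by words with too few letters from T *)
pose e (w : word 'I_n.+1 (option T)) (t : N0) : 'I_n.+1 :=
  nth ord0 (enum [pred j | w j : bool]) (enum_rank t).
have e_mem w t : B w -> w (e w t).
  move=> Bw; have : e w t \in enum [pred j | w j : bool].
    by apply: mem_nth; rewrite -cardE (leq_trans _ Bw).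
  by rewrite mem_enum.
have e_inj w : B w -> injective (e w).
  move=> Bw t u /eqP; rewrite nth_uniq ?enum_uniq // -?cardE ?(leq_trans _ Bw) //.
  by move=> /eqP /ord_inj/enum_rank_inj.
have supp w v : B w ->
    [pred j | splice Some (e w) w v j : bool] =1 [pred j | w j : bool].
  move=> Bw j; rewrite /= ffunE; case: pickP => [t /eqP<-|//].
  by rewrite e_mem.
have /card_gt0P[a _] := T0.
have hs : \sum_(w | B w) \sum_v (D (splice Some (e w) w v))%:R =
          #|word N0 T|%:R * \sum_(w | B w) (D w)%:R :> R.
  apply: (sum_splice (g := odflt a)) => //.
  - by move=> w v Bw; rewrite /B (eq_card (supp w v Bw)).
  - by move=> w v Bw; apply/funext => t; rewrite /e (eq_enum (supp w v Bw)).
  - by move=> w t Bw; have := e_mem w t Bw; case: (w _).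
have W0 : 0 < #|word N0 T|%:R :> R by rewrite ltr0n card_word_gt0.
have [w Bw hw] : exists2 w, B w & has_density (c / 2)
    (fun v => D (splice Some (e w) w v)).
  apply: contrapT => hn2; move: dD; rewrite /has_density (bigID B) /=.
  apply/negP; rewrite -ltNge.
  have h1 : \sum_(w | B w) (D w)%:R <= c / 2 * #|word 'I_n.+1 (option T)|%:R :> R.
    rewrite -(ler_pM2l W0) -hs.
    apply: (@le_trans _ _ (\sum_(w : word 'I_n.+1 (option T))
        c / 2 * #|word N0 T|%:R)).
      rewrite [leLHS]big_mkcond; apply: ler_sum => w _; case: ifPn => Bw.
        by rewrite leNgt; apply/negP => /ltW h; apply: hn2; exists w.
      by rewrite mulr_ge0 ?divr_ge0 // ltW.
    by rewrite sumr_const -[leLHS]mulr_natr mulrCA mulrA.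
  have h2 : \sum_(w | ~~ B w) (D w)%:R <= c / 4 * #|word 'I_n.+1 (option T)|%:R :> R.
    apply: (@le_trans _ _ (2 ^+ #|N0| * (3 / 4) ^+ n.+1 *
        #|word 'I_n.+1 (option T)|%:R)); last by rewrite ler_wpM2r.
    apply: le_trans (few_short_words _ _ _ T0); rewrite big_mkcond.
    by apply: ler_sum => w _; rewrite /B -ltnNge; case: ltnP => //; case: (D w).
  have : 0 < #|word 'I_n.+1 (option T)|%:R :> R.
    by rewrite ltr0n card_word_gt0 ?card_option.
  nra.
have [L [[t Lt] hL]] := hN0 _ hw.
pose L' : word 'I_n.+1 (option (option T)) :=
  [ffun j => if [pick t | e w t == j] is Some t then omap Some (L t)
             else Some (w j)].
have L'S b : line L' (Some b) = splice Some (e w) w (line L b).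
  apply/ffunP => j; rewrite !ffunE; case: pickP => //= u _.
  by rewrite ffunE; case: (L u).
exists L'; split.
  exists (e w t); rewrite ffunE; case: pickP => [u /eqP/(e_inj _ Bw) ->|/(_ t)].
    by rewrite Lt.
  by rewrite eqxx.
case=> [b|]; first by rewrite L'S hL.
rewrite hD (_ : collapse i _ = collapse i (line L' (Some i))).
  by rewrite -hD L'S hL.
by apply/ffunP => j; rewrite !ffunE; case: pickP => //= u _; case: (L u).
Qed.

Lemma subst_transport (I J J' K : finType) (f : J -> J')
    (V : word I (J + K)%type) : (forall j', exists j, f j = j') -> spans V ->
  exists2 V' : word I (J' + K)%type, spans V' &
    forall x : word J' K, subst V' x = subst V [ffun j => x (f j)].
Proof.
move=> fs /forallP sV.
exists [ffun i => match V i with inl j => inl (f j) | inr a => inr a end].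
  apply/forallP => j'; have [j <-] := fs j'; have /existsP[i /eqP Vi] := sV j.
  by apply/existsP; exists i; rewrite ffunE Vi.
by move=> x; apply/ffunP => i; rewrite !ffunE; case: (V i) => // j; rewrite ffunE.
Qed.

Definition contains_subspace (J I K : finType) (D : pred (word I K)) : Prop :=
  exists2 V : word I (J + K)%type, spans V & forall u, D (subst V u).

(** Wildcards are found one at a time: by pigeonhole many suffixes y share one
    line on the first block, and the set of these y is again insensitive. *)
Lemma insensitive_subspace (R : realType) (T : finType) (i : T) :
  (forall c : R, 0 < c -> DHJ T c) ->
  forall (J : finType) (c : R), 0 < c ->
  exists I : finType, forall D : pred (word I (option T)),
    insensitive i D -> has_density c D -> contains_subspace J D.
Proof.
move=> hT J.
suff H n (c : R) : 0 < c -> exists I : finType,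
    forall D : pred (word I (option T)),
    insensitive i D -> has_density c D -> contains_subspace 'I_n D.
  move=> c c0; have [I hI] := H #|J| c c0; exists I => D iD dD.
  have [V sV hV] := hI D iD dD.
  have [|V' sV' hV'] := @subst_transport _ _ J _ (@enum_val J J) _ _ sV.
    by move=> j; exists (enum_rank j); rewrite enum_rankK.
  by exists V' => // u; rewrite hV'.
elim: n c => [|n IH] c c0.
  exists void => D iD dD.
  have [x Dx] : exists x, D x.
    apply: contrapT => hn; move: dD; rewrite /has_density big1 => [|x _].
      by rewrite leNgt mulr_gt0 // ltr0n card_word_gt0 // card_option.
    by case Dx: (D x) => //; case: hn; exists x.
  exists [ffun j => inr (x j)]; first by apply/forallP => -[].
  by move=> u; rewrite (_ : subst _ u = x) //; apply/ffunP => -[].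
have c2 : 0 < c / 2 by rewrite divr_gt0.
have [I1 hI1] := insensitive_line i c2 (hT _ (divr_gt0 c2 (ltr0Sn _ 1))).
have W1 : (0 < #|word I1 (option T)|)%N by rewrite card_word_gt0 // card_option.
pose k : R := #|word I1 (option (option T))|%:R.
have k0 : 0 < k by rewrite ltr0n card_word_gt0 // card_option.
have [I2 hI2] := IH (c / 2 / k) (divr_gt0 c2 k0).
exists (I1 + I2)%type => D iD; rewrite /has_density card_word_sum natrM sum_wcat.
move=> /(heavy_fibres W1 (ltW c0)) heavy.
have [|||L /existsP[q0 /eqP Lq0] dL] := pigeonhole_density
    (P := fun L : word I1 (option (option T)) => [exists q, L q == None])
    (E := fun L y => [forall a, D (wcat (line L a) y)]) _ _ heavy.
- by [].
- by rewrite card_word_gt0 // card_option.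
- move=> y hy; have [|L [[q Lq] hL]] := hI1 (fun x => D (wcat x y)) _ hy.
    exact: insensitive_fibre_l.
  by exists L; [apply/existsP; exists q; rewrite Lq | apply/forallP].
have [|V /forallP sV hV] := hI2 _ _ dL.
  by move=> y; apply: eq_forallb => a; exact: (insensitive_fibre (line L a) iD).
exists [ffun q => match q with
  | inl q => if L q is Some a then inr a else inl ord0
  | inr q => match V q with inl j => inl (lift ord0 j) | inr a => inr a end
  end].
  apply/forallP => j; apply/existsP; case: (unliftP ord0 j) => [j' ->|->].
    have /existsP[q /eqP Vq] := sV j'.
    by exists (inr q); rewrite ffunE Vq.
  by exists (inl q0); rewrite ffunE Lq0.
move=> u; have /forallP/(_ (u ord0)) := hV [ffun j => u (lift ord0 j)].
congr (D _); apply/ffunP => -[q|q]; rewrite !ffunE; first by case: (L q).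
by case: (V q) => // j; rewrite ffunE.
Qed.

(** * Partition of insensitive sets into subspaces *)

Lemma subst_inj (J I K : finType) (V : word I (J + K)%type) :
  spans V -> injective (@subst J I K V).
Proof.
move=> /forallP sV x y /ffunP e; apply/ffunP => j.
by have /existsP[i /eqP Vi] := sV j; have := e i; rewrite !ffunE Vi.
Qed.

(** If D is, up to a proportion eta of all words, a disjoint union of subspaces
    of dimension #|J|, then summing f over the pieces gives this inequality.
    This is the purpose of such a partition, and in this form partitions compose
    without any bookkeeping of families of subspaces. *)
Definition nearly_partitioned (R : realType) (J I K : finType)
    (D : pred (word I K)) (eta : R) : Prop :=
  forall f : word I K -> R, (forall x, f x <= 1) ->
    (forall V : word I (J + K)%type, spans V -> (forall u, D (subst V u)) ->
       \sum_u f (subst V u) <= 0) ->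
  \sum_(x | D x) f x <= eta * #|word I K|%:R.

Fixpoint blocks (I0 : finType) (r : nat) : finType :=
  if r is r'.+1 then (I0 + blocks I0 r')%type else void.

(** As long as D has density above eta, many of its fibres in the first block
    contain a subspace; removing one from each such fibre lowers the density by
    a fixed amount, so r blocks exhaust D if r is large.  What remains of D is
    no longer insensitive in the first block, but the removed subspace depends
    only on the fibre, which is the same for interchangeable suffixes, so it is
    still insensitive in the remaining blocks.  The finite type X indexes the
    blocks already treated. *)
Lemma partition_blocks (R : realType) (T : finType) (i : T) (J I0 : finType)
    (eta : R) : 0 < eta ->
  (forall D : pred (word I0 (option T)),
     insensitive i D -> has_density (eta / 2) D -> contains_subspace J D) ->
  forall (r : nat) (X : finType)
    (D : X -> pred (word (blocks I0 r) (option T)))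
    (f : X -> word (blocks I0 r) (option T) -> R),
  (forall x, insensitive i (D x)) -> (forall x y, f x y <= 1) ->
  (forall x (V : word (blocks I0 r) (J + option T)%type),
     spans V -> (forall u, D x (subst V u)) -> \sum_u f x (subst V u) <= 0) ->
  \sum_x \sum_y (D x y)%:R <=
    (eta + r%:R * (eta / 2 / #|word I0 (option T)|%:R)) *
    (#|X|%:R * #|word (blocks I0 r) (option T)|%:R) ->
  \sum_x \sum_(y | D x y) f x y <=
    eta * (#|X|%:R * #|word (blocks I0 r) (option T)|%:R).
Proof.
move=> eta0 H; elim=> [|r IH] X D f iD f1 fV.
  rewrite mul0r addr0; apply: le_trans; apply: ler_sum => x _.
  rewrite big_mkcond; apply: ler_sum => y _.
  by case: (D x y); [exact: f1|exact: lexx].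
set W0 := word I0 (option T); set Wr := word (blocks I0 r) (option T).
have cW0 : (0 < #|W0|)%N by rewrite card_word_gt0 // card_option.
have pW0 : 0 < #|W0|%:R :> R by rewrite ltr0n.
rewrite card_word_sum natrM => massD.
have [small|large] := leP (\sum_x \sum_y ((D x y)%:R : R))
    (eta * (#|X|%:R * (#|W0|%:R * #|Wr|%:R))).
  apply: le_trans small; apply: ler_sum => x _.
  rewrite big_mkcond; apply: ler_sum => y _.
  by case: (D x y); [exact: f1|exact: lexx].
pose pk x (y : Wr) := [pick V : word I0 (J + option T)%type |
  spans V && [forall u, D x (wcat (subst V u) y)]].
pose removed x (z : W0) (y : Wr) :=
  if pk x y is Some V then [exists u, z == subst V u] else false.
pose D' (p : X * W0) (y : Wr) := D p.1 (wcat p.2 y) && ~~ removed p.1 p.2 y.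
have rem_D x z y : removed x z y -> D x (wcat z y).
  rewrite /removed /pk; case: pickP => // V /andP[_ /forallP hV].
  by case/existsP => u /eqP->.
have pk_collapse x y : pk x y = pk x (collapse i y).
  apply: eq_pick => V /=; congr andb; apply: eq_forallb => u.
  exact: (insensitive_fibre _ (iD x)).
have decomp (g : X -> word (I0 + blocks I0 r)%type (option T) -> R) :
    \sum_x \sum_(w | D x w) g x w =
    \sum_p \sum_(y | D' p y) g p.1 (wcat p.2 y) +
    \sum_x \sum_y \sum_(z | removed x z y) g x (wcat z y).
  rewrite -(pair_bigA _ (fun x z => \sum_(y | D' (x, z) y) g x (wcat z y))) /=.
  rewrite -big_split /=; apply: eq_bigr => x _.
  rewrite big_mkcond sum_wcat [X in _ + X](exchange_big_dep predT) //=.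
  rewrite -big_split /=; apply: eq_bigr => z _.
  rewrite -big_mkcond (bigID (removed x z)) addrC /=; congr (_ + _).
  by apply: eq_bigl => y; case Er: (removed x z y); rewrite ?andbF // (rem_D _ _ _ Er).
have IH' : \sum_p \sum_(y | D' p y) f p.1 (wcat p.2 y) <=
    eta * (#|{: X * W0}|%:R * #|Wr|%:R).
  apply: IH => [[x z] y|[x z] y|[x z] V sV hV|].
  - rewrite /D' /removed pk_collapse; congr andb.
    exact: (insensitive_fibre z (iD x)).
  - exact: f1.
  - pose V' : word (I0 + blocks I0 r)%type (J + option T)%type :=
      [ffun q => match q with inl q => inr (z q) | inr q => V q end].
    have V'S u : subst V' u = wcat z (subst V u).
      by apply/ffunP => -[q|q]; rewrite !ffunE.
    have -> : \sum_u f x (wcat z (subst V u)) = \sum_u f x (subst V' u).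
      by apply: eq_bigr => u _; rewrite V'S.
    apply: fV => [|u]; last by rewrite V'S; have /andP[] := hV u.
    apply/forallP => j; have /forallP/(_ j)/existsP[q /eqP Vq] := sV.
    by apply/existsP; exists (inr q); rewrite ffunE Vq.
  - have := decomp (fun _ _ => 1).
    have ind (A : finType) (P : pred A) : \sum_(a | P a) 1 = \sum_a (P a)%:R :> R.
      by rewrite big_mkcond; apply: eq_bigr => a _; case: (P a).
    under eq_bigr do rewrite ind.
    under [X in _ = X + _]eq_bigr do rewrite ind.
    have : eta / 2 * (#|X|%:R * #|Wr|%:R) <=
        \sum_x \sum_y \sum_(z | removed x z y) 1 :> R.
      pose F z (p : X * Wr) := D p.1 (wcat z p.2).
      have : eta * (#|W0|%:R * #|{: X * Wr}|%:R) <=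
          \sum_z \sum_p (F z p)%:R :> R.
        rewrite card_prod natrM [X in eta * X]mulrCA (le_trans (ltW large)) //.
        rewrite [leRHS]exchange_big /=; apply: (@le_trans _ _
          (\sum_x \sum_y \sum_z (D x (wcat z y))%:R)); last by rewrite pair_bigA.
        apply: ler_sum => x _; rewrite sum_wcat exchange_big.
        exact: lexx.
      move=> /(heavy_fibres cW0 (ltW eta0)).
      rewrite /has_density card_prod natrM => /le_trans; apply.
      rewrite [leRHS]pair_bigA; apply: ler_sum => -[x y] _ /=.
      rewrite -/(has_density (eta / 2) (fun z => F z (x, y))).
      case: (boolP (has_density _ _)) => [heavy|_]; last by rewrite sumr_ge0.
      have [|V sV hV] := H (fun z => D x (wcat z y)) _ heavy.
        exact: insensitive_fibre_l.
      have [V0 pkV0] : exists V0, pk x y = Some V0.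
        rewrite /pk; case: pickP => [V0 _|/(_ V)]; first by exists V0.
        by rewrite /= sV => /negbT/forallP; case.
      rewrite (bigD1 (subst V0 [ffun=> None])) /= ?lerDl ?sumr_ge0 //.
      by rewrite /removed pkV0; apply/existsP; exists [ffun=> None].
    have e : (eta + r.+1%:R * (eta / 2 / #|W0|%:R)) *
        (#|X|%:R * (#|W0|%:R * #|Wr|%:R)) =
      (eta + r%:R * (eta / 2 / #|W0|%:R)) * (#|X|%:R * (#|W0|%:R * #|Wr|%:R))
      + eta / 2 * (#|X|%:R * #|Wr|%:R).
      by rewrite -natr1; field; rewrite lt0r_neq0.
    rewrite e in massD; rewrite card_prod natrM -(mulrA #|X|%:R).
    lra.
(* the removed subspaces contribute at most 0, the rest is the hypothesis IH *)
apply: (@le_trans _ _ (\sum_p \sum_(y | D' p y) f p.1 (wcat p.2 y))); last first.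
  by apply: le_trans IH' _; rewrite card_prod natrM -(mulrA #|X|%:R).
rewrite decomp gerDl; apply: sumr_le0 => x _; apply: sumr_le0 => y _.
rewrite /removed; case Epk: (pk x y) => [V|]; last by rewrite big_pred0.
move: Epk; rewrite /pk; case: pickP => // V0 /andP[sV /forallP hV] [<-{V}].
have -> : \sum_(z | [exists u, z == subst V0 u]) f x (wcat z y) =
          \sum_u f x (wcat (subst V0 u) y).
  rewrite -(big_imset (h := subst V0) (fun z => f x (wcat z y))) /=; last first.
    by move=> u v _ _; apply: (subst_inj sV).
  apply: eq_bigl => z; apply/existsP/imsetP => -[u].
    by move=> /eqP ->; exists u.
  by move=> _ ->; exists u.
pose V' : word (I0 + blocks I0 r)%type (J + option T)%type :=
  [ffun q => match q with inl q => V0 q | inr q => inr (y q) end].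
have V'S u : wcat (subst V0 u) y = subst V' u.
  by apply/ffunP => -[q|q]; rewrite !ffunE.
rewrite (eq_bigr (fun u => f x (subst V' u))) => [|u _]; last by rewrite V'S.
apply: fV => [|u]; last by rewrite -V'S.
apply/forallP => j; have /forallP/(_ j)/existsP[q /eqP Vq] := sV.
by apply/existsP; exists (inl q); rewrite ffunE Vq.
Qed.

Lemma insensitive_partition (R : realType) (T : finType) (i : T) :
  (forall c : R, 0 < c -> DHJ T c) ->
  forall (J : finType) (eta : R), 0 < eta ->
  exists I : finType, forall D : pred (word I (option T)),
    insensitive i D -> nearly_partitioned J D eta.
Proof.
move=> hT J eta eta0.
have [I0 hI0] := insensitive_subspace i hT J (divr_gt0 eta0 (ltr0Sn _ 1)).
have W0 : 0 < #|word I0 (option T)|%:R :> R.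
  by rewrite ltr0n card_word_gt0 // card_option.
pose c := eta / 2 / #|word I0 (option T)|%:R.
have c0 : 0 < c by rewrite !divr_gt0.
pose r := (Num.truncn (1 / c)).+1.
have hr : 1 <= r%:R * c.
  by rewrite -ler_pdivrMr // ltW // truncnS_gt.
exists (blocks I0 r) => D iD f f1 fV.
have := @partition_blocks R T i J I0 eta eta0 hI0 r unit
  (fun _ => D) (fun _ => f) (fun _ => iD) (fun _ => f1) (fun _ => fV).
rewrite card_unit !mul1r !big_const card_unit /= !addr0; apply.
apply: le_trans (sum_indicator_le_card _ _) _.
rewrite -[leLHS]mul1r ler_wpM2r //; apply: le_trans hr _.
by rewrite lerDr ltW.
Qed.

Definition compose (J L I K : finType) (V : word I (L + K)%type)
    (U : word L (J + K)%type) : word I (J + K)%type :=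
  [ffun q => match V q with inl l => U l | inr a => inr a end].

Lemma subst_compose (J L I K : finType) (V : word I (L + K)%type)
    (U : word L (J + K)%type) x :
  subst (compose V U) x = subst V (subst U x).
Proof. by apply/ffunP => q; rewrite !ffunE; case: (V q) => // l; rewrite ffunE. Qed.

Lemma spans_compose (J L I K : finType) (V : word I (L + K)%type)
    (U : word L (J + K)%type) : spans V -> spans U -> spans (compose V U).
Proof.
move=> /forallP sV /forallP sU; apply/forallP => j.
have /existsP[l /eqP Ul] := sU j; have /existsP[q /eqP Vq] := sV l.
by apply/existsP; exists q; rewrite ffunE Vq Ul.
Qed.

Lemma insensitive_subst (J I T : finType) (i : T)
    (V : word I (J + option T)%type) (D : pred (word I (option T))) :
  insensitive i D -> insensitive i (fun u => D (subst V u)).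
Proof.
move=> iD u; rewrite iD [RHS]iD; congr (D _); apply/ffunP => q; rewrite !ffunE.
by case: (V q) => // j; rewrite ffunE; case: (u j).
Qed.

(** Partition the first set into subspaces of huge dimension; within each of
    them the remaining sets are still insensitive, so their intersection can be
    partitioned further.  Subtracting eta / 2 from the test function absorbs
    the error of the second stage into the first. *)
Lemma intersection_partition (R : realType) (T : finType) :
  (forall c : R, 0 < c -> DHJ T c) ->
  forall (s : seq T) (J : finType) (eta : R), 0 < eta ->
  exists I : finType, forall D : T -> pred (word I (option T)),
    (forall i, insensitive i (D i)) ->
    nearly_partitioned J (fun x => all (fun i => D i x) s) eta.
Proof.
move=> hT; elim=> [|i s IH] J eta eta0.
  exists J => D _ f f1 fV; apply: (@le_trans _ _ 0); last by rewrite mulr_ge0 // ltW.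
  pose V : word J (J + option T)%type := [ffun j => inl j].
  have VE u : subst V u = u by apply/ffunP => j; rewrite !ffunE.
  apply: le_trans (fV V _ _) => //; last first.
    by apply/forallP => j; apply/existsP; exists j; rewrite ffunE.
  by rewrite le_eqVlt; apply/orP; left; apply/eqP/eq_bigr => u _; rewrite VE.
have eta2 : 0 < eta / 2 by rewrite divr_gt0.
have [L hL] := IH J (eta / 2) eta2.
have [I hI] := insensitive_partition i hT L eta2.
exists I => D iD f f1 fV.
pose S x := all (fun j => D j x) s.
pose g x := (if S x then f x else 0) - eta / 2.
have g1 x : g x <= 1.
  by rewrite /g; case: (S x); [have := f1 x; lra | lra].
have gV V : spans V -> (forall u, D i (subst V u)) ->
    \sum_(u : word L (option T)) g (subst V u) <= 0.
  move=> sV hV; rewrite /g sumrB -big_mkcond sumr_const -[_ *+ _]mulr_natr subr_le0.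
  apply: (hL (fun j u => D j (subst V u)) _ (fun u => f (subst V u))) => //.
    by move=> j; exact: insensitive_subst.
  move=> U sU hU; under eq_bigr do rewrite -subst_compose.
  apply: fV; first exact: spans_compose.
  by move=> u; rewrite subst_compose /= hV hU.
have := hI (D i) (iD i) g g1 gV.
rewrite /g sumrB -big_mkcondr /= sumr_const -[_ *+ _]mulr_natr.
have : #|D i|%:R <= #|word I (option T)|%:R :> R by rewrite ler_nat max_card.
rewrite (eq_bigl (fun x => all (fun j => D j x) (i :: s))) //.
nra.
Qed.

(** * The density increment *)

Lemma contains_line_subst (J I K : finType) (V : word I (J + K)%type)
    (D : pred (word I K)) : spans V ->
  contains_line (fun u => D (subst V u)) -> contains_line D.
Proof.
move=> /forallP sV [L [[j Lj] hL]].
exists [ffun q => match V q with inl j => L j | inr a => Some a end]; split.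
  by have /existsP[q /eqP Vq] := sV j; exists q; rewrite ffunE Vq.
move=> a; have := hL a; congr (D _); apply/ffunP => q; rewrite !ffunE.
by case: (V q) => // j'; rewrite ffunE.
Qed.

Lemma contains_line_fibre (I J K : finType) (D : pred (word (I + J)%type K))
    (x : word I K) : contains_line (fun y => D (wcat x y)) -> contains_line D.
Proof.
pose V : word (I + J)%type (J + K)%type :=
  [ffun q => match q with inl i => inr (x i) | inr j => inl j end].
have VE y : wcat x y = subst V y by apply/ffunP => -[q|q]; rewrite !ffunE.
under eq_fun do rewrite VE.
apply: contains_line_subst; apply/forallP => j; apply/existsP.
by exists (inr j); rewrite ffunE.
Qed.

(** The subspace of dimension #|N| determined by z: a letter [None] of z at
    (j, t) is a further occurrence of the j-th wildcard.  If x is a line with a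
    wildcard at j, then letting the block of z at j vary moves over a whole
    space of words, in which [None] still plays the part of the wildcard. *)
Definition pad (N Z T : finType) (z : word (N * Z)%type (option T))
    (x : word N (option T)) : word (N + N * Z)%type (option T) :=
  [ffun p => match p with
   | inl j => x j
   | inr q => if z q is Some a then Some a else x q.1
   end].

(** The word L over [option T], read as a line over T, is itself the last point
    of a line over [option T] whose other points are the [fill a L]. *)
Definition fill (N T : finType) (a : T) (L : word N (option T)) :
  word N (option T) := [ffun j => Some (odflt a (L j))].

Lemma exists_ge0_term (R : realType) (X : finType) (g : X -> R) :
  (0 < #|X|)%N -> 0 <= \sum_x g x -> exists x, 0 <= g x.
Proof.
move=> /card_gt0P[x0 _] g0; apply: contrapT => hn; move: g0; apply/negP.
have : \sum_x g x < \sum_(x : X) 0.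
  apply: ltr_sum; first by apply/hasP; exists x0; rewrite ?mem_index_enum.
  by move=> x _; rewrite ltNge; apply/negP => h; apply: hn; exists x.
by rewrite big1_eq ltNge.
Qed.

Lemma pad_line (N Z Y T : finType) (A : pred (word (N + N * Z + Y)%type (option T)))
    (z : word (N * Z)%type (option T)) (y : word Y (option T))
    (L : word N (option T)) (j0 : N) : L j0 = None ->
  (forall a, A (wcat (pad z (fill a L)) y)) -> A (wcat (pad z L) y) ->
  contains_line A.
Proof.
move=> Lj hA hL.
exists [ffun p => match p with
  | inl q => omap Some (pad z L q) | inr q => Some (y q) end]; split.
  by exists (inl (inl j0)); rewrite !ffunE Lj.
case=> [a|].
  have := hA a; congr (A _); apply/ffunP => -[[j|[j t]]|q]; rewrite !ffunE //=.
    by case: (L j).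
  by case: (z _) => //=; case: (L j).
move: hL; congr (A _); apply/ffunP => -[[j|[j t]]|q]; rewrite !ffunE //=.
  by case: (L j).
by case: (z _) => //=; case: (L j).
Qed.

(** The average of the fibre densities is at least d - e and none exceeds
    d + e, so with finitely many fibres none can be much smaller than d. *)
Lemma dense_fibres (R : realType) (I J K : finType) (d e : R)
    (A : pred (word (I + J)%type K)) : (0 < #|K|)%N -> 0 <= e ->
  (forall x : word I K, ~ has_density (d + e) (fun y => A (wcat x y))) ->
  has_density (d - e) A ->
  forall x : word I K,
    has_density (d - 2 * #|word I K|%:R * e) (fun y => A (wcat x y)).
Proof.
move=> K0 e0 up; rewrite /has_density card_word_sum natrM sum_wcat => low x.
have : \sum_(x' | x' != x) \sum_y (A (wcat x' y))%:R <=
    (#|word I K|%:R - 1) * ((d + e) * #|word J K|%:R).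
  apply: (@le_trans _ _ (\sum_(x' | x' != x) (d + e) * #|word J K|%:R)).
    by apply: ler_sum => x' _; rewrite ltW // ltNge; apply/negP/up.
  rewrite sumr_const -[leLHS]mulr_natl (_ : #|_| = #|word I K|.-1); last first.
    by rewrite -(cardC1 x); apply: eq_card => x'; rewrite !inE.
  by rewrite -subn1 natrB ?card_word_gt0.
move: low; rewrite (bigD1 x) //=.
have : 0 <= #|word J K|%:R :> R by [].
nra.
Qed.

(** If all densities above d force a line, so does some density below d.  The
    choices are made in the order N, g, J, Z, e0, Y: the increment g has to be
    fixed before the dimension J, and e0 can be taken small depending on all of
    these because the fibres over Y only need the density d + e0. *)
Lemma DHJ_below (R : realType) (T : finType) (d : R) :
  (0 < #|T|)%N -> 0 < d -> (forall c : R, 0 < c -> DHJ T c) ->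
  (forall c, d < c -> DHJ (option T) c) ->
  exists2 e, 0 < e & DHJ (option T) (d - e).
Proof.
move=> T0 d0 hT hK.
have K0 : (0 < #|{: option T}|)%N by rewrite card_option.
have d4 : 0 < d / 2 / 2 by rewrite !divr_gt0.
have [N hN] := hT _ d4.
pose k : R := #|word N (option T)|%:R.
have k0 : 0 < k by rewrite ltr0n card_word_gt0.
pose th := d / 2 / 2 / k.
have th0 : 0 < th by rewrite divr_gt0.
pose g := th * d / 4.
have g0 : 0 < g by rewrite divr_gt0 // mulr_gt0.
have [J hJ] := hK (d + g) ltac:(lra).
pose eta := g / 2 / #|{: {ffun T -> bool}}|%:R.
have B0 : 0 < #|{: {ffun T -> bool}}|%:R :> R.
  by rewrite ltr0n card_ffun card_bool expn_gt0.
have eta0 : 0 < eta by rewrite divr_gt0 // divr_gt0.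
have [Z hZ] := intersection_partition hT (enum T) J eta0.
pose Q : finType := (N + N * Z)%type.
have Q0 : 0 < #|word Q (option T)|%:R :> R by rewrite ltr0n card_word_gt0.
pose e1 := Num.min g (d / 2).
have e10 : 0 < e1 by rewrite lt_min g0 divr_gt0.
have e1g : e1 <= g by rewrite ge_min lexx.
have e1d : e1 <= d / 2 by rewrite ge_min lexx orbT.
pose e0 := e1 / (2 * #|word Q (option T)|%:R).
have e00 : 0 < e0 by rewrite divr_gt0 ?mulr_gt0.
have [Y hY] := hK (d + e0) ltac:(lra).
exists e0 => //; exists (Q + Y)%type => A hA.
apply: contrapT => noline.
have fib (x : word Q (option T)) :
    (d - e1) * #|word Y (option T)|%:R <= \sum_y (A (wcat x y))%:R.
  have := dense_fibres K0 (ltW e00) _ hA x.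
  rewrite /has_density (_ : d - _ = d - e1); last first.
    by rewrite /e0; field; rewrite lt0r_neq0.
  by apply=> x' dx'; apply: noline; apply: contains_line_fibre (hY _ dx').
pose ZW := word (N * Z)%type (option T); pose YW := word Y (option T).
pose good (L : word N (option T)) (p : ZW * YW) :=
  [forall a, A (wcat (pad p.1 (fill a L)) p.2)].
have Y0 : (0 < #|YW|)%N by rewrite card_word_gt0.
have ZW0 : (0 < #|ZW|)%N by rewrite card_word_gt0.
(* By the theorem for T each padding z has, for many y, a line L over T with
   all points in A; a positive proportion of the (z, y) share the same L. *)
have [L /existsP[j0 /eqP Lj0] hL] : exists2 L : word N (option T),
    [exists j, L j == None] & has_density th (good L).
  pose F (v : word N T) (p : ZW * YW) :=
    A (wcat (pad p.1 [ffun j => Some (v j)]) p.2).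
  have WN : (0 < #|word N T|)%N by rewrite card_word_gt0.
  have heavy : d / 2 * (#|word N T|%:R * #|{: ZW * YW}|%:R) <=
      \sum_v \sum_p (F v p)%:R.
    rewrite card_prod natrM.
    apply: (@le_trans _ _ (\sum_(v : word N T) \sum_(z : ZW)
        (d - e1) * #|YW|%:R)).
      rewrite !sumr_const -!mulrnA -[leRHS]mulr_natr natrM.
      have m0 : 0 <= #|YW|%:R * (#|ZW|%:R * #|word N T|%:R) :> R by rewrite !mulr_ge0.
      have := ler_wpM2r m0 (_ : d / 2 <= d - e1).
      by move=> /(_ ltac:(lra)); lra.
    apply: ler_sum => v _; rewrite -(pair_bigA _ (fun z y => (F v (z, y))%:R)) /=.
    by apply: ler_sum => z _; exact: (fib (pad z [ffun j => Some (v j)])).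
  have := heavy_fibres WN (ltW (divr_gt0 d0 (ltr0Sn _ 1))) heavy.
  move=> /pigeonhole_density; apply => //; first by rewrite card_prod muln_gt0 ZW0.
  move=> p /hN[L [[j Lj] hL]]; exists L.
    by apply/existsP; exists j; rewrite Lj.
  apply/forallP => a; have := hL a; congr (A (wcat (pad _ _) _)).
  by apply/ffunP => j'; rewrite !ffunE.
(* The excess of A over density d + g off the good pairs, less a margin g.  Its
   mean is nonnegative, so it is so for some choice of everything but the block
   of z at j0. *)
pose H (z : ZW) (y : YW) : R := (A (wcat (pad z L) y))%:R
  - (d + g) * (1 - (good L (z, y))%:R) - g.
have H0 : 0 <= \sum_z \sum_y H z y.
  have hA' : (d - e1) * (#|ZW|%:R * #|YW|%:R) <=
      \sum_z \sum_y (A (wcat (pad z L) y))%:R.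
    apply: (@le_trans _ _ (\sum_(z : ZW) (d - e1) * #|YW|%:R)).
      by rewrite sumr_const -[leRHS]mulr_natr; lra.
    by apply: ler_sum => z _; exact: fib.
  have hL' : th * (#|ZW|%:R * #|YW|%:R) <= \sum_z \sum_y (good L (z, y))%:R.
    rewrite -natrM -card_prod; apply: le_trans hL _.
    by rewrite pair_bigA; apply: ler_sum => -[].
  have -> : \sum_z \sum_y H z y = \sum_z \sum_y (A (wcat (pad z L) y))%:R
      - (d + g) * (#|ZW|%:R * #|YW|%:R - \sum_z \sum_y (good L (z, y))%:R)
      - g * (#|ZW|%:R * #|YW|%:R).
    rewrite !pair_bigA /H /= !sumrB -mulr_sumr sumrB !sumr_const.
    by rewrite card_prod -[g *+ _]mulr_natr natrM.
  set M := #|ZW|%:R * #|YW|%:R in hA' hL' *.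
  have M0 : 0 <= M by rewrite mulr_ge0.
  have dg : 0 <= d + g by lra.
  have h1 := ler_wpM2l dg hL'.
  have h2 : 0 <= (d - e1 - (d + g) * (1 - th) - g) * M.
    rewrite mulr_ge0 //.
    have : th * d = 4 * g by rewrite /g; field.
    have : 0 <= g * th by rewrite mulr_ge0 // ltW.
    lra.
  lra.
pose sp (z : ZW) (z0 : word Z (option T)) : ZW := splice id (pair j0) z z0.
have pinj : injective (pair j0 : Z -> N * Z) by move=> t u [].
have sp0 : 0 <= \sum_z \sum_z0 \sum_y H (sp z z0) y.
  rewrite (sum_splice (B := predT) (e := fun _ => pair j0) (g := id)
    (fun z => \sum_y H z y)) //.
  by rewrite mulr_ge0.
have [[z y] hzy] : exists p : ZW * YW, 0 <= \sum_z0 H (sp p.1 z0) p.2.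
  apply: exists_ge0_term; first by rewrite card_prod muln_gt0 ZW0.
  rewrite -(pair_bigA _ (fun z y => \sum_z0 H (sp z z0) y)) /=.
  by under eq_bigr do rewrite exchange_big.
rewrite /= in hzy.
(* Inside the block at j0 the set A becomes A', the points that complete lines
   form the intersection of the sets D a, and A' misses it. *)
pose A' z0 := A (wcat (pad (sp z z0) L) y).
pose D a z0 := A (wcat (pad (sp z z0) (fill a L)) y).
have iD a : insensitive a (D a).
  move=> z0; congr (A (wcat _ _)); apply/ffunP => -[j|[j t]]; rewrite !ffunE //.
  case: pickP => [u /eqP[<- <-]|//].
  by rewrite ?ffunE; case: (z0 u) => //=; rewrite ?ffunE Lj0.
pose V0 : word (Q + Y)%type (Z + option T)%type := [ffun p => match p with
  | inl (inl j) => inr (L j)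
  | inl (inr (j, t)) =>
      if j == j0 then inl t else inr (if z (j, t) is Some a then Some a else L j)
  | inr q => inr (y q) end].
have V0S z0 : subst V0 z0 = wcat (pad (sp z z0) L) y.
  apply/ffunP => -[[j|[j t]]|q]; rewrite !ffunE //.
  case: pickP => [u /eqP[<- <-]|no].
    by rewrite eqxx Lj0; case: (z0 u).
  case: eqP => [e|//].
  by have := no t; rewrite e eqxx.
have noline' : ~ contains_line A'.
  move=> h; apply: noline; apply: (@contains_line_subst _ _ _ V0).
    by apply/forallP => t; apply/existsP; exists (inl (inr (j0, t))); rewrite ffunE eqxx.
  by under eq_fun do rewrite V0S.
have disj z0 : A' z0 -> ~~ [forall a, D a z0].
  by move=> h; apply/negP => /forallP h'; apply: noline; exact: pad_line Lj0 h' h.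
pose f z0 : R := (A' z0)%:R - (d + g).
have f1 z0 : f z0 <= 1 by rewrite /f; case: (A' z0); rewrite ?mulr1n ?mulr0n; lra.
have fV (V : word Z (J + option T)%type) : spans V -> \sum_u f (subst V u) <= 0.
  move=> sV; rewrite /f sumrB sumr_const -[_ *+ _]mulr_natr subr_le0 leNgt.
  apply/negP => /ltW /hJ h; apply: noline'; exact: contains_line_subst sV h.
have W0 : 0 < #|word Z (option T)|%:R :> R by rewrite ltr0n card_word_gt0.
have big : g * #|word Z (option T)|%:R <= \sum_(z0 | ~~ [forall a, D a z0]) f z0.
  rewrite -subr_ge0; apply: le_trans hzy _.
  have -> : g * #|word Z (option T)|%:R = \sum_(z0 : word Z (option T)) g.
    by rewrite sumr_const mulr_natr.
  rewrite [X in _ <= X - _]big_mkcond /= -sumrB; apply: ler_sum => z0 _.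
  have -> : H (sp z z0) y =
      (A' z0)%:R - (d + g) * (1 - [forall a, D a z0]%:R) - g by [].
  have := disj z0; rewrite /f; case: (A' z0); case: [forall a, _] => h;
    rewrite ?mulr1n ?mulr0n /=; lra.
(* the complement of the intersection is the union, over the patterns b that are
   not constantly true, of intersections of the D a and their complements *)
have small : \sum_(z0 | ~~ [forall a, D a z0]) f z0 <=
    #|{: {ffun T -> bool}}|%:R * (eta * #|word Z (option T)|%:R).
  rewrite (partition_big (fun z0 => [ffun a => D a z0] : {ffun T -> bool}) predT) //=.
  rewrite mulr_natl -sumr_const; apply: ler_sum => b _.
  have [all1|nall] := boolP [forall a, b a].
    rewrite big_pred0 => [|z0]; first by rewrite mulr_ge0 ?ltW.
    apply/negP => /andP[/negP h /eqP e]; apply: h.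
    by apply/forallP => a; have /forallP/(_ a) := all1; rewrite -e ffunE.
  have := hZ (fun a z0 => D a z0 == b a) _ f f1 (fun V sV _ => fV V sV).
  move=> /(_ (fun a z0 => congr1 (fun c => c == b a) (iD a z0))) h.
  apply: le_trans h; rewrite le_eqVlt; apply/orP; left; apply/eqP; apply: eq_bigl.
  move=> z0; apply/andP/allP => [[_ /eqP <-] a _|h]; first by rewrite ffunE.
  have e : [ffun a => D a z0] = b.
    by apply/ffunP => a; rewrite ffunE; apply/eqP/h; rewrite mem_enum.
  rewrite e eqxx; split=> //; apply: contra nall => /forallP h'.
  by apply/forallP => a; rewrite -e ffunE.
have : #|{: {ffun T -> bool}}|%:R * (eta * #|word Z (option T)|%:R) =
    g / 2 * #|word Z (option T)|%:R.
  by rewrite /eta; field; rewrite lt0r_neq0.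
nra.
Qed.

(** * The density Hales-Jewett theorem *)

Lemma DHJ_weaken (R : realType) (K : finType) (c c' : R) :
  c <= c' -> DHJ K c -> DHJ K c'.
Proof.
move=> cc' [I hI]; exists I => D hD; apply: hI.
by apply: le_trans hD; rewrite ler_wpM2r.
Qed.

(** The infimum of the densities that force a line cannot be positive, since by
    [DHJ_below] a smaller density would force one as well. *)
Lemma DHJ_option (R : realType) (T : finType) : (0 < #|T|)%N ->
  (forall c : R, 0 < c -> DHJ T c) ->
  forall c : R, 0 < c -> DHJ (option T) c.
Proof.
move=> T0 hT c c0; apply: contrapT => hc.
pose S : set R := fun c => 0 < c /\ DHJ (option T) c.
have lbS s : S s -> c <= s.
  by move=> [_ hs]; rewrite leNgt; apply/negP => /ltW/DHJ_weaken/(_ hs).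
have S2 : S 2.
  split=> //; exists void => D; rewrite /has_density card_ffun card_void expn0.
  have := sum_indicator_le_card R D; rewrite card_ffun card_void expn0.
  by move=> h1 h2; exfalso; lra.
have infS : has_inf S by split; [exists 2 | exists c => s /lbS].
have cd : c <= inf S by apply: lb_le_inf; [exists 2 | move=> s /lbS].
have d0 : 0 < inf S by exact: lt_le_trans cd.
have [e e0 he] : exists2 e, 0 < e & DHJ (option T) (inf S - e).
  apply: DHJ_below => // c' dc'.
  have [s [_ hs] sc'] := inf_adherent (eps := c' - inf S) ltac:(lra) infS.
  by apply: DHJ_weaken hs; lra.
pose m := Num.max (inf S - e) (inf S / 2).
have Sm : S m.
  split; first by rewrite lt_max divr_gt0 ?orbT.
  by apply: DHJ_weaken he; rewrite le_max lexx.
have : inf S <= m by apply: ge_inf => //; exact: infS.2.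
by rewrite leNgt gt_max; apply/negP/negPn/andP; split; lra.
Qed.

Fixpoint letters (l : nat) : finType :=
  if l is l'.+1 then option (letters l') else unit.

Lemma card_letters l : #|letters l| = l.+1.
Proof. by elim: l => [|l IH] /=; rewrite ?card_unit // card_option IH. Qed.

Lemma density_Hales_Jewett (R : realType) (l : nat) (c : R) :
  0 < c -> DHJ (letters l) c.
Proof.
elim: l c => [|l IH] c c0; last by apply: DHJ_option => //; rewrite card_letters.
exists unit => D; rewrite /has_density => hD.
have [x Dx] : exists x, D x.
  apply: contrapT => hn; move: hD; rewrite big1 => [|x _].
    by rewrite leNgt mulr_gt0 // ltr0n card_word_gt0 // card_unit.
  by case Dx: (D x) => //; case: hn; exists x.
exists [ffun=> None]; split; first by exists tt; rewrite ffunE.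
move=> a; rewrite (_ : line _ a = x) //.
by apply/ffunP => i; rewrite !ffunE /=; case: a; case: (x i).
Qed.

Fixpoint digit (l : nat) : letters l -> nat :=
  if l is l'.+1 return letters l -> nat
  then fun a => if a is Some b then digit b else l'.+1
  else fun=> 0%N.

Lemma digit_surj l k : (k <= l)%N -> exists a : letters l, digit a = k.
Proof.
elim: l => [|l IH]; first by rewrite leqn0 => /eqP->; exists tt.
rewrite leq_eqVlt => /predU1P[->|/IH[b <-]]; first by exists None.
by exists (Some b).
Qed.

(** * Returns along a line of words *)

(** Integrate the pointwise alternative: a point lies either in less than a
    proportion c / 2 of the sets B w, or in all the sets B w along some line. *)
Lemma probability_line (R : realType) (d : measure_display)
    (X : measurableType d) (mu : probability X R) (K I : finType) (c : R)
    (B : word I K -> set X) : (0 < #|K|)%N -> 0 < c ->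
  (forall D : pred (word I K), has_density (c / 2) D -> contains_line D) ->
  (forall w, measurable (B w)) -> (forall w, (c%:E <= mu (B w))%E) ->
  exists L : word I (option K), (exists i, L i = None) /\
    ((c / 2 / #|word I (option K)|%:R)%:E <= mu (\bigcap_a B (line L a)))%E.
Proof.
move=> K0 c0 hI mB hB.
pose C (L : word I (option K)) : set X :=
  if [exists i, L i == None] then \bigcap_a B (line L a) else set0.
have mC L : measurable (C L).
  rewrite /C; case: ifP => _; last exact: measurable0.
  by apply: fin_bigcap_measurable => // a _; exact: mB.
pose W : R := #|word I K|%:R.
have W0 : 0 < W by rewrite ltr0n card_word_gt0.
pose k : R := #|word I (option K)|%:R.
have k0 : 0 < k by rewrite ltr0n card_word_gt0 // card_option.
have pt x : ((\sum_w \1_(B w) x) <= W * (\sum_L \1_(C L) x) + c / 2 * W :> R)%R.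
  have -> : \sum_w \1_(B w) x = \sum_w (x \in B w)%:R :> R.
    by apply: eq_bigr => w _; rewrite indicE.
  have s0 : 0 <= \sum_L \1_(C L) x :> R.
    by apply: sumr_ge0 => L _; rewrite indicE.
  case: (boolP (has_density (c / 2) (fun w => x \in B w))) => [hx|].
    have [L [[i Li] hL]] := hI _ hx.
    have : 1 <= \sum_L \1_(C L) x :> R.
      have LN : [exists i, L i == None] by apply/existsP; exists i; rewrite Li.
      rewrite (bigD1 L) //= indicE mem_set; last first.
        by rewrite /C LN => a _ /=; have := hL a; rewrite inE.
      by rewrite lerDl sumr_ge0 // => L' _; rewrite indicE.
    have := sum_indicator_le_card R (fun w => x \in B w); rewrite -/W.
    have : 0 < c / 2 * W by rewrite mulr_gt0 ?divr_gt0.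
    nra.
  rewrite /has_density -ltNge -/W => /ltW.
  have : 0 <= W * \sum_L \1_(C L) x by rewrite mulr_ge0 // ltW.
  lra.
have mI (S : set X) : measurable S -> measurable_fun [set: X] (EFin \o (\1_S : X -> R)).
  by move=> mS; apply/measurable_EFinP; exact: measurable_indic.
have : (\sum_w mu (B w) <= W%:E * \sum_L mu (C L) + (c / 2 * W)%:E)%E.
  have -> : (\sum_w mu (B w) = \int[mu]_x (\sum_w (\1_(B w) x)%:E))%E.
    rewrite ge0_integral_sum //=; last by move=> w; exact: mI.
    by apply: eq_bigr => w _; rewrite integral_indic // setIT.
  have mS : measurable_fun [set: X]
      ((fun x => \sum_L (\1_(C L) x)%:E)%E : X -> \bar R).
    by apply: emeasurable_sum => L _; exact: mI.
  have -> : (W%:E * \sum_L mu (C L) + (c / 2 * W)%:E =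
      \int[mu]_x (W%:E * (\sum_L (\1_(C L) x)%:E) + (c / 2 * W)%:E))%E.
    rewrite ge0_integralD //=; last 3 first.
    - move=> x _; apply: mule_ge0; first by rewrite lee_fin ltW.
      by apply: sume_ge0 => L _; rewrite lee_fin indicE.
    - exact: measurable_funeM.
    - by move=> x _; rewrite lee_fin mulr_ge0 ?divr_ge0 ?ltW.
    have -> : (\int[mu]_x (c / 2 * W)%:E = (c / 2 * W)%:E)%E.
      by rewrite integral_cst //= probability_setT mule1.
    rewrite ge0_integralZl //=; last 2 first.
    - by move=> x _; rewrite sume_ge0 // => L _; rewrite lee_fin indicE.
    - by rewrite lee_fin ltW.
    rewrite ge0_integral_sum //=; last by move=> L; exact: mI.
    congr (_ * _ + _)%E; apply: eq_bigr => L _.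
    by rewrite integral_indic // setIT.
  apply: ge0_le_integral => //=.
  - by move=> x _; rewrite sume_ge0 // => w _; rewrite lee_fin indicE.
  - by apply: emeasurable_sum => w _; exact: mI.
  - by apply: emeasurable_funD => //; exact: measurable_funeM.
  - by move=> x _; rewrite !sumEFin -EFinM -EFinD lee_fin.
move=> hint; apply: contrapT => hn.
have small L : (mu (C L) < (c / 2 / k)%:E)%E.
  rewrite /C; case: ifPn => [/existsP[i /eqP Li]|_]; last first.
    by rewrite measure0 lte_fin !divr_gt0.
  rewrite ltNge; apply/negP => h; apply: hn; exists L; split=> //.
  by exists i.
have fin S : measurable S -> mu S = (fine (mu S))%:E.
  by move=> mS; rewrite fineK // fin_num_measure.
have lt2 : \sum_L fine (mu (C L)) < c / 2.
  have -> : c / 2 = \sum_(L : word I (option K)) (c / 2 / k).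
    by rewrite sumr_const -[RHS]mulr_natr -/k divfK // lt0r_neq0.
  apply: ltr_sum => [|L _]; last by rewrite -lte_fin -fin.
  by apply/hasP; exists [ffun=> None]; rewrite ?mem_index_enum.
have ge : W * c <= \sum_w fine (mu (B w)).
  have -> : W * c = \sum_(w : word I K) c by rewrite sumr_const mulr_natl.
  by apply: ler_sum => w _; rewrite -lee_fin -fin.
move: hint; rewrite (eq_bigr _ (fun w _ => fin _ (mB w))).
rewrite [in leRHS](eq_bigr _ (fun L _ => fin _ (mC L))).
rewrite !sumEFin -EFinM -EFinD lee_fin.
nra.
Qed.

(** * Subproducts that avoid a sparse set *)

Definition count_upto (P : pred nat) (N : nat) : nat := count P (iota 1 N).

(** Otherwise the count up to M^j * N1 would be at least M^(2*j) for all j, but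
    it is at most M^j * N1, which is smaller for large j. *)
Lemma subquadratic_growth (P : pred nat) (M N0 : nat) :
  (1 < M)%N -> (exists2 g, (0 < g)%N & P g) ->
  exists N, [/\ (N0 <= N)%N, (0 < count_upto P N)%N &
    (count_upto P (M * N) <= M ^ 2 * count_upto P N)%N].
Proof.
move=> M1 [g g0 Pg]; pose N1 := maxn N0 g.
have c0 N : (N1 <= N)%N -> (0 < count_upto P N)%N.
  rewrite geq_max => /andP[_ gN]; rewrite -has_count; apply/hasP; exists g => //.
  by rewrite mem_iota g0 add1n ltnS.
apply: contrapT => hn.
have grow N : (N1 <= N)%N -> (M ^ 2 * count_upto P N < count_upto P (M * N))%N.
  move=> hN; rewrite ltnNge; apply/negP => h; apply: hn; exists N; split=> //.
    by apply: leq_trans hN; exact: leq_maxl.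
  exact: c0.
have pow j : (M ^ (2 * j) <= count_upto P (M ^ j * N1))%N.
  elim: j => [|j IH]; first by rewrite !expn0 mul1n c0.
  rewrite mulnS expnD; apply: (@leq_trans (M ^ 2 * count_upto P (M ^ j * N1))%N).
    by rewrite leq_mul2l IH orbT.
  rewrite [(M ^ j.+1)%N]expnS -mulnA ltnW // grow // leq_pmull // expn_gt0.
  by rewrite (ltnW M1).
have := leq_trans (pow N1) (count_size _ _).
rewrite size_iota mul2n -addnn expnD leq_pmul2l ?expn_gt0 ?(ltnW M1) //.
by rewrite leqNgt ltn_expl.
Qed.

Lemma count_has (S : Type) (Y : Type) (p : S -> Y -> bool) (ys : seq Y) (s : seq S) :
  (count (fun n => has (p n) ys) s <= \sum_(y <- ys) count (p^~ y) s)%N.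
Proof.
elim: ys => [|y ys IH]; first by rewrite big_nil (eq_count (a2 := pred0)) ?count_pred0.
rewrite big_cons; apply: leq_trans (leq_add (leqnn _) IH).
rewrite -(count_predUI (p^~ y) (fun n => has (p n) ys)) leq_addr //.
Qed.

(** If each n in P up to N had an exceptional product n*y, the exceptional set
    up to M*N would contain a fixed proportion of the elements of P up to N,
    hence also of those up to M*N if P grows slowly between N and M*N. *)
Lemma dilates_avoid (P Bad : pred nat) (ys : seq nat) :
  (exists2 g, (0 < g)%N & P g) ->
  (forall y, y \in ys -> (0 < y)%N /\ forall n, P n -> P (n * y)%N) ->
  (forall K, exists N0, forall N, (N0 <= N)%N -> (0 < count_upto P N)%N ->
     (K * count_upto (predI P Bad) N < count_upto P N)%N) ->
  exists n, P n /\ forall y, y \in ys -> ~~ Bad (n * y)%N.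
Proof.
move=> hP hys hBad.
pose M := (2 + \sum_(y <- ys) y)%N.
have yM y : y \in ys -> (y <= M)%N.
  by move=> yy; rewrite /M (big_rem y) //= addnCA leq_addr.
have [N0 hN0] := hBad (M ^ 2 * (size ys).+1)%N.
have [N [N0N cN gN]] := subquadratic_growth N0 (isT : (1 < M)%N) hP.
apply: contrapT => hn.
have all_bad n : P n -> has (fun y => Bad (n * y)%N) ys.
  move=> Pn; apply: contrapT => /negP/hasPn h; apply: hn; exists n; split=> //.
have cle : (count_upto P N <= size ys * count_upto (predI P Bad) (M * N))%N.
  pose p n y := P n && Bad (n * y)%N.
  apply: (@leq_trans (count (fun n => has (p n) ys) (iota 1 N))).
    apply: sub_count => n Pn; have /hasP[y yy By] := all_bad n Pn.
    by apply/hasP; exists y => //; rewrite /p Pn.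
  apply: leq_trans (count_has _ _ _) _.
  rewrite -sum1_size big_distrl /= big_seq [leqRHS]big_seq.
  apply: leq_sum => y yy; rewrite mul1n /count_upto -!size_filter.
  have [y0 yP] := hys y yy.
  rewrite -(size_map (muln^~ y)); apply: uniq_leq_size.
    rewrite map_inj_uniq ?filter_uniq ?iota_uniq // => a b /eqP.
    by rewrite eqn_pmul2r // => /eqP.
  move=> m /mapP[n]; rewrite mem_filter mem_iota => /andP[/andP[Pn Bn]].
  move=> /andP[n1 nN] ->; rewrite mem_filter mem_iota /= yP // Bn /=.
  rewrite muln_gt0 n1 y0 /= add1n ltnS mulnC leq_mul ?yM //.
have MN : (N <= M * N)%N by rewrite leq_pmull.
have cMN : (count_upto P N <= count_upto P (M * N))%N.
  by rewrite /count_upto -(subnKC MN) iotaD count_cat leq_addr.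
have := hN0 _ (leq_trans N0N MN) (leq_trans cN cMN).
rewrite ltnNge => /negP; apply; apply: leq_trans gN _.
rewrite -mulnA leq_mul2l; apply/orP; right; apply: leq_trans cle _.
by rewrite leq_mul2r leqnSn orbT.
Qed.

(** The next element n is chosen such that its products with all subproducts of
    the elements chosen so far (including the empty product) are good. *)
Lemma subproducts_avoid (P Bad : pred nat) (I : finType) :
  (exists g, P g) -> (forall n, P n -> (0 < n)%N) ->
  (forall n m, P n -> P m -> P (n * m)%N) ->
  (forall K, exists N0, forall N, (N0 <= N)%N -> (0 < count_upto P N)%N ->
     (K * count_upto (predI P Bad) N < count_upto P N)%N) ->
  exists x : I -> nat, (forall i, P (x i)) /\
    forall J : {set I}, J != finset.set0 -> ~~ Bad (\prod_(i in J) x i)%N.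
Proof.
move=> [g Pg] P0 PM hBad.
suff H (e : seq I) : uniq e -> exists x : I -> nat, (forall i, P (x i)) /\
    forall J : {set I}, {subset J <= e} -> J != finset.set0 ->
      ~~ Bad (\prod_(i in J) x i)%N.
  have [x [xP xB]] := H _ (enum_uniq I); exists x; split=> // J; apply: xB.
  by move=> i _; rewrite mem_enum.
elim: e => [|i e IH] /=.
  exists (fun=> g); split=> // J sJ /finset.set0Pn[i /sJ]; by rewrite in_nil.
move=> /andP[ie /IH[x [xP xB]]].
pose ys := [seq (\prod_(j in J) x j)%N | J : {set I} <- enum {: {set I}}].
have PMp n (J : {set I}) : P n -> P (n * \prod_(j in J) x j)%N.
  move=> Pn; apply: (big_rec (fun m => P (n * m)%N)) => [|j m _ Pm]; first by rewrite muln1.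
  by rewrite mulnCA; apply: PM.
have [|y|n [Pn nB]] := dilates_avoid (ys := ys) _ _ hBad.
- by exists g; rewrite ?P0.
- move=> /mapP[J _ ->]; split; last by move=> n; exact: PMp.
  by rewrite prodn_gt0 // => j; apply: P0.
exists (fun j => if j == i then n else x j); split=> [j|J sJ J0].
  by case: eqP.
have rest (J' : {set I}) : i \notin J' ->
    (\prod_(j in J') (if j == i then n else x j) = \prod_(j in J') x j)%N.
  move=> iJ; apply: eq_bigr => j jJ; case: eqP => // ji.
  by rewrite -ji jJ in iJ.
have [iJ|iJ] := boolP (i \in J).
  rewrite (big_setD1 i) //= eqxx rest ?finset.setD11 //; apply: nB.
  by apply: map_f; rewrite mem_enum.
rewrite rest //; apply: xB => // j jJ; have := sJ j jJ.
by rewrite in_cons => /predU1P[ji|//]; rewrite -ji jJ in iJ.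
Qed.

(** * Averages over a multiplicative semigroup *)

Lemma average_count (R : realType) (G : set nat) (f : nat -> R) (N : nat) :
  average (G `&` initial_segment N) f =
  (count_upto (fun n => `[< G n >]) N)%:R^-1 *
  \sum_(n <- iota 1 N | `[< G n >]) f n.
Proof.
set E := G `&` initial_segment N.
have finE : finite_set E.
  apply: (sub_finite_set (B := [set` iota 1 N])); last exact: finite_seq.
  by move=> n [_ /= /andP[n1 nN]]; rewrite /= mem_iota n1 add1n ltnS.
have perm : perm_eq (fset_set E) [seq n <- iota 1 N | `[< G n >]].
  apply: uniq_perm => [||n]; first exact: fset_uniq.
    by rewrite filter_uniq ?iota_uniq.
  rewrite in_fset_set // mem_filter mem_iota add1n ltnS.
  apply/idP/andP => [|[/asboolP Gn nN]]; last by rewrite inE.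
  by rewrite inE => -[Gn nN]; split=> //; apply/asboolP.
rewrite /average fsbig_finite //= (perm_big _ perm) big_filter.
by rewrite (perm_size perm) size_filter.
Qed.

Lemma eventually_lt_limn_esup (R : realType) (u : nat -> R) (eta : R) :
  (limn_esup (fun N => (u N)%:E) < eta%:E)%E ->
  exists N0, forall N, (N0 <= N)%N -> u N < eta.
Proof.
move=> /ereal_inf_lt[_ [V [N0 _ hV] <-] hlt]; exists N0 => N N0N.
rewrite -lte_fin; apply: le_lt_trans hlt; apply: ereal_sup_ubound.
by exists N => //; apply: hV.
Qed.

Lemma sparse_of_small_averages (R : realType) (G : set nat) (f : nat -> R)
    (eps : R) (K : nat) :
  0 < eps -> (forall n, 0 <= f n) ->
  ~ (0 < limn_esup (fun N => (average (G `&` initial_segment N) f)%:E))%E ->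
  exists N0, forall N, (N0 <= N)%N ->
    (0 < count_upto (fun n => `[< G n >]) N)%N ->
    (K * count_upto (predI (fun n => `[< G n >]) (fun n => eps <= f n)%R) N <
     count_upto (fun n => `[< G n >]) N)%N.
Proof.
move=> eps0 f0 /negP; rewrite -leNgt => sup0.
have eta0 : 0 < eps / K.+1%:R by rewrite divr_gt0.
have [|N0 hN0] := @eventually_lt_limn_esup R
  (fun N => average (G `&` initial_segment N) f) (eps / K.+1%:R).
  by apply: le_lt_trans sup0 _; rewrite lte_fin.
exists N0 => N N0N; have := hN0 N N0N; rewrite average_count.
set c := count_upto _ N; set b := count_upto _ N => small c0.
have cp : 0 < c%:R :> R by rewrite ltr0n.
have : eps * b%:R <= \sum_(n <- iota 1 N | `[< G n >]) f n.
  rewrite /b /count_upto -sum1_count natr_sum mulr_sumr big_mkcond.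
  rewrite [leRHS]big_mkcond; apply: ler_sum => n _ /=.
  by case: asboolP => //= _; case: ifP; rewrite ?mulr1.
move: small; rewrite mulrC ltr_pdivrMr // => /[swap] /le_lt_trans /[apply].
rewrite -mulrA ltr_pM2l // ltr_pdivlMl // -natrM ltr_nat.
by apply: leq_ltn_trans; rewrite leq_mul2r leqnSn orbT.
Qed.

Lemma measurable_multiple_return (R : realType) (d : measure_display)
    (X : measurableType d) (mu : probability X R) (T : nat -> X -> X)
    (A : set X) (l n : nat) : mult_system mu T -> measurable A -> (0 < n)%N ->
  measurable (multiple_return T A l n).
Proof.
move=> hT mA n0; apply: measurableI => //; apply: bigcap_measurableType => k _.
have nk0 : (0 < n ^ k)%N by rewrite expn_gt0 n0.
have [mT _] := mult_system_preserving hT nk0.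
by rewrite -[_ @^-1` _]setTI; apply: mT.
Qed.

(** * Multiple recurrence along a multiplicative semigroup *)

Theorem theorem1p3 (R : realType) (d : measure_display) (X : measurableType d)
    (mu : probability X R) (T : nat -> X -> X) (hT : mult_system mu T)
    (A : set X) (mA : measurable A) (hA : (0 < mu A)%E)
    (G : set nat) (hG : mult_subsemigroup G)
    (l : nat) (hl : (1 <= l)%N) :
  (0 < limn_esup (fun N : nat =>
    (average (G `&` initial_segment N)
       (fun n : nat => fine (mu (multiple_return T A l n))))%:E))%E.
Proof.
apply: contrapT => hsup.
pose a := fine (mu A).
have muA : mu A = a%:E by rewrite fineK // fin_num_measure.
have a0 : 0 < a by rewrite -lte_fin -muA.
have [I hI] := @density_Hales_Jewett R l (a / 2) ltac:(by rewrite divr_gt0).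
pose eps := a / 2 / #|word I (option (letters l))|%:R.
have eps0 : 0 < eps.
  by rewrite !divr_gt0 // ltr0n card_word_gt0 // card_option.
pose P n := `[< G n >].
have P0 n : P n -> (0 < n)%N by move=> /asboolP; apply: mult_subsemigroup_gt0.
have PM n m : P n -> P m -> P (n * m)%N.
  by move=> /asboolP Gn /asboolP Gm; apply/asboolP; apply: mult_subsemigroup_mul.
have [|//|//|K|x [xP xB]] := @subproducts_avoid P
    (fun n => eps <= fine (mu (multiple_return T A l n))) I.
- by have [g Gg] := mult_subsemigroup_nonempty hG; exists g; apply/asboolP.
- by apply: sparse_of_small_averages => // n; rewrite fine_ge0.
pose p (w : word I (letters l)) := (\prod_i x i ^ digit (w i))%N.
have p0 w : (0 < p w)%N.
  by rewrite prodn_gt0 // => i; rewrite expn_gt0 P0.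
have [|w|w|L [[i0 Li0] hL]] := probability_line (mu := mu)
    (B := fun w => T (p w) @^-1` A) _ a0 hI.
- by rewrite card_letters.
- rewrite -[_ @^-1` _]setTI.
  by have [mT _] := mult_system_preserving hT (p0 w); apply: mT.
- have [_ ->] // := mult_system_preserving hT (p0 w).
  by rewrite muA.
pose J : {set I} := [set i | L i == None]%SET.
pose n := (\prod_(i in J) x i)%N.
pose c := (\prod_(i | L i != None) x i ^ (if L i is Some b then digit b else 0))%N.
have n0 : (0 < n)%N by rewrite prodn_gt0 // => i; apply: P0.
have c0 : (0 < c)%N by rewrite prodn_gt0 // => i; rewrite expn_gt0 P0.
have pL b : p (line L b) = (n ^ digit b * c)%N.
  rewrite /p (bigID (fun i => L i == None)) /=; congr (_ * _)%N.
    rewrite /n (big_morph (expn^~ _) (fun a b => expnMn a b _) (exp1n _)); apply: eq_big => [i|i /eqP Li]; first by rewrite inE.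
    by rewrite ffunE Li.
  by apply: eq_bigr => i; rewrite ffunE; case: (L i).
have sub : \bigcap_b (T (p (line L b)) @^-1` A) `<=`
    T c @^-1` multiple_return T A l n.
  move=> y hy; split=> /=.
    have [b b0] := digit_surj (leq0n l).
    by have := hy b Logic.I; rewrite pL b0 mul1n.
  move=> k /= /andP[_ kl]; have [b bk] := digit_surj kl.
  have := hy b Logic.I; rewrite pL bk /= (mult_system_comp hT) //.
  by rewrite expn_gt0 n0.
have mM := measurable_multiple_return l hT mA n0.
have nJ : J != finset.set0 by apply/finset.set0Pn; exists i0; rewrite inE Li0.
have /negP := xB J nJ; apply; rewrite -lee_fin fineK ?fin_num_measure //.
have [mTc preTc] := mult_system_preserving hT c0.
apply: le_trans hL _; rewrite -(preTc _ mM).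
apply: le_measure; rewrite ?inE //.
  apply: fin_bigcap_measurable => // b _; rewrite -[X in measurable X]setTI.
  by have [mT _] := mult_system_preserving hT (p0 (line L b)); apply: mT.
by rewrite -[X in measurable X]setTI; apply: mTc.
Qed.
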